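(* Let $\Phi$ be a real-valued continuously differentiable function with locally Lipschitz gradient on an open neighborhood of $\Delta_n$. Let $x:[0,+\infty)\to\mathbb R^n$ solve $$\dot x=-\bigl(\operatorname{diag}(x)-xx^\top\bigr)\nabla\Phi(x),\qquad x(0)\in\operatorname{ri}(\Delta_n),$$ and assume that $x(t)\to x^\star\in\Delta_n$ as $t\to+\infty$. Set $\tau^\star:=x^{\star\top}\nabla\Phi(x^\star)$. Then, for every $i$, $$x_i^\star>0\ \Longrightarrow\ \nabla_i\Phi(x^\star)=\tau^\star,\qquad\text{and}\qquad x_i^\star=0\ \Longrightarrow\ \nabla_i\Phi(x^\star)\ge\tau^\star.$$ Hence $x^\star$ satisfies the KKT conditions of the problem $\min_{x\in\Delta_n}\Phi(x)$.
   Context: $\Delta_n=\{x\in\mathbb R^n: x\ge0,\ \mathbf 1^\top x=1\}$ is the probability simplex, $\mathbf 1$ is the all-ones vector, and $\operatorname{ri}(\Delta_n)=\{x\in\Delta_n: x_i>0\ \forall i\}$. $\operatorname{diag}(x)$ is the diagonal matrix with diagonal $x$, and $\nabla_i\Phi$ is the $i$-th component of the Euclidean gradient. The KKT conditions of $\min_{x\in\Delta_n}\Phi(x)$ at $x^\star\in\Delta_n$ are: there exist $\nu^\star\in\mathbb R$ and $\lambda^\star\in\mathbb R^n$ with $\nabla\Phi(x^\star)+\nu^\star\mathbf 1-\lambda^\star=0$, $\lambda^\star\ge0$, and $\lambda_i^\star x_i^\star=0$ for all $i$. *)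

(* Defs.v *)
From HB Require Import structures.
From mathcomp Require Import all_boot all_order all_algebra.
From mathcomp Require Import all_classical all_reals all_analysis.

Set Implicit Arguments.
Unset Strict Implicit.
Unset Printing Implicit Defensive.

Import Order.TTheory GRing.Theory Num.Theory.
Import numFieldNormedType.Exports.

Local Open Scope classical_set_scope.
Local Open Scope ring_scope.

Definition dotv (R : realType) (n : nat) (u v : 'cV[R]_n) : R :=
  (u^T *m v) 0 0.

Definition simplex (R : realType) (n : nat) : set 'cV[R]_n :=
  [set x : 'cV[R]_n | (forall i, 0 <= x i 0) /\ dotv (const_mx 1) x = 1].

Definition ri_simplex (R : realType) (n : nat) : set 'cV[R]_n :=
  [set x : 'cV[R]_n | simplex x /\ forall i, 0 < x i 0].

Definition gradient (R : realType) (n : nat) (Phi : 'cV[R]_n -> R)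
    (p : 'cV[R]_n) : 'cV[R]_n :=
  \col_i 'D_(delta_mx i 0) Phi p.

(* In the next two definitions U is meant to be open, so that nothing depends
   on the values of Phi outside U. *)
Definition continuously_differentiable_on (R : realType) (n : nat)
    (U : set 'cV[R]_n) (Phi : 'cV[R]_n -> R) : Prop :=
  forall p, U p ->
    differentiable Phi p /\ {for p, continuous (gradient Phi)}.

(* The norm on matrices is the sup norm; local Lipschitz continuity does not
   depend on the choice of a norm on R^n. *)
Definition locally_lipschitz_on (R : realType) (n : nat) (U : set 'cV[R]_n)
    (f : 'cV[R]_n -> 'cV[R]_n) : Prop :=
  forall p, U p -> exists2 V, nbhs p V & [lipschitz f y | y in V].

Definition replicator_field (R : realType) (n : nat) (Phi : 'cV[R]_n -> R)
    (x : 'cV[R]_n) : 'cV[R]_n :=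
  - ((diag_mx x^T - x *m x^T) *m gradient Phi x).

(* x : [0, +oo) -> U solves x' = f(x), where f is a field on U. The derivative
   at 0 is the right derivative: x t is irrelevant for t < 0. *)
Definition solves_ode (R : realType) (n : nat) (U : set 'cV[R]_n)
    (f : 'cV[R]_n -> 'cV[R]_n) (x : R -> 'cV[R]_n) : Prop :=
  [/\ forall t : R, 0 <= t -> U (x t),
      h^-1 *: (x h - x 0) @[h --> 0^'+] --> f (x 0) &
      forall t : R, 0 < t -> is_derive t 1 x (f (x t))].

Definition KKT_simplex (R : realType) (n : nat) (Phi : 'cV[R]_n -> R)
    (x : 'cV[R]_n) : Prop :=
  exists (nu : R) (lambda : 'cV[R]_n),
    [/\ gradient Phi x + nu *: const_mx 1 - lambda = 0,
        forall i, 0 <= lambda i 0 &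
        forall i, lambda i 0 * x i 0 = 0].

(* Main.v *)
Require Import Defs.
From mathcomp Require Import all_boot all_order all_algebra.
From mathcomp Require Import all_classical all_reals all_analysis.
From mathcomp Require Import ring lra.

Set Implicit Arguments.
Unset Strict Implicit.

Import Order.TTheory GRing.Theory Num.Theory.
Import numFieldNormedType.Exports.

Local Open Scope classical_set_scope.
Local Open Scope ring_scope.

(**
The i-th coordinate of the replicator equation reads x_i' = x_i c_i, where
the growth rate c_i(x) = x^T grad Phi(x) - (grad Phi(x))_i is a continuous
function of x. Along the trajectory c_i therefore converges to
cstar_i = tau - (grad Phi(xstar))_i, and the whole claim is about the sign of
cstar_i.

If xstar_i > 0, then x_i' converges to xstar_i cstar_i. A convergent function
whose derivative converges has derivative limit 0 (cvg_derive_lim0, by the mean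
value theorem on intervals of length 1), so cstar_i = 0.

If xstar_i = 0 and cstar_i > 0, then x_i^2, whose derivative is 2 c_i x_i^2, is
eventually nondecreasing, and so it cannot tend to 0 unless it is
eventually zero (linear_ode_not_cvg0). It never vanishes: x_i solves the
scalar linear equation y' = y c with c continuous, so a Gronwall argument
keeps y nonzero once y(0) is (linear_ode_neq0). Squares are used so that the
sign of x_i(t) does not matter, which avoids a first-exit-time argument.

The KKT multipliers are then nu = - tau and lambda = grad Phi(xstar) - tau 1:
the two cases above are dual feasibility and complementary slackness.
*)

Lemma is_derive_ge0_le (R : realType) (f df : R -> R) (a b : R) :
  a <= b -> {within `[a, b], continuous f} ->
  (forall t, t \in `]a, b[ -> is_derive t 1 f (df t)) ->
  (forall t, t \in `]a, b[ -> 0 <= df t) ->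
  f a <= f b.
Proof.
rewrite le_eqVlt => /predU1P[-> //|ab] cf dfE df_ge0.
have [t tab] := MVT ab dfE cf.
rewrite -(subr_ge0 (f a)) => ->.
by rewrite mulr_ge0 ?df_ge0// subr_ge0 ltW.
Qed.

(** The increments y (s + 1) - y s tend to l - l = 0, while the mean value
    theorem writes them as values of dy at points beyond s, which tend to m. *)
Lemma cvg_derive_lim0 (R : realType) (y dy : R -> R) (l m : R) :
  (forall t : R, 0 < t -> is_derive t 1 y (dy t)) ->
  y t @[t --> +oo] --> l -> dy t @[t --> +oo] --> m -> m = 0.
Proof.
move=> yE yl dym; apply/eqP/negPn/negP => m_neq0.
(* Three errors enter the final comparison (y at s, y at s + 1, dy between),
   so a tolerance of |m| / 4 leaves a strict gap. *)
have e_gt0 : 0 < `|m| / 4 by rewrite divr_gt0// normr_gt0.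
have [A [_ yA]] := cvgr_dist_lt _ _ yl _ e_gt0.
have [B [_ dyB]] := cvgr_dist_lt _ _ dym _ e_gt0.
pose s := Num.max 0 (Num.max A B) + 1.
have [s0 sA sB] : [/\ 0 < s, A < s & B < s].
  rewrite /s; split; rewrite -[ltLHS]addr0 ler_ltD// !le_max lexx ?orbT//.
have ss1 : s < s + 1 by rewrite ltrDl.
have [||t tss1 yss1] := @MVT _ y dy s (s + 1) ss1.
- by move=> t; rewrite in_itv/= => /andP[st _]; apply: yE; exact: lt_trans st.
- apply: derivable_within_continuous => t; rewrite in_itv/= => /andP[st _].
  by have [] := yE t (lt_le_trans s0 st).
move: tss1; rewrite in_itv/= => /andP[st _].
have h1 : `|l - y s| < `|m| / 4 by exact: yA.
have h2 : `|l - y (s + 1)| < `|m| / 4 by apply: yA; exact: lt_trans ss1.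
have h3 : `|m - dy t| < `|m| / 4 by apply: dyB; exact: lt_trans st.
have dyt : dy t = y (s + 1) - y s by rewrite yss1 [s + 1]addrC addrK mulr1.
move: h1 h2 h3; rewrite dyt !ltr_norml.
by case: (ger0P m) => _ /andP[? ?] /andP[? ?] /andP[? ?]; lra.
Qed.

Lemma is_derive_sqr (R : realType) (y : R -> R) (t d : R) :
  is_derive t 1 y d -> is_derive t 1 (fun s => y s ^+ 2) (2 * y t * d).
Proof.
move=> yE; have := is_deriveX 2 yE.
rewrite /= expr1 => h; exact: h.
Qed.

(** With m the minimum of c on [0, T], the function y^2 exp(- 2 m t) has
    derivative 2 y^2 (c - m) exp(- 2 m t) >= 0, so its value at T is at least
    its value y(0)^2 > 0 at 0. *)
Lemma linear_ode_neq0 (R : realType) (y c : R -> R) (T : R) :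
  0 <= T -> {within `[0, T], continuous y} -> {within `[0, T], continuous c} ->
  (forall t, t \in `]0, T[ -> is_derive t 1 y (y t * c t)) ->
  y 0 != 0 -> y T != 0.
Proof.
move=> T_ge0 y_cont c_cont yE y0.
have [s _ cs] := EVT_min T_ge0 c_cont.
pose k := - (2 * c s).
pose E (t : R) : R := expR (k * t).
have EE (t : R) : is_derive t 1 E (k * E t).
  have -> : k * E t = expR (k * t) * (k *: 1) by rewrite mulrC [k *: 1]mulr1.
  exact: (@is_derive1_comp _ expR ( *%R k)).
have : y 0 ^+ 2 * E 0 <= y T ^+ 2 * E T.
  apply: (@is_derive_ge0_le _ (fun t => y t ^+ 2 * E t)
    (fun t => 2 * y t ^+ 2 * (c t - c s) * E t)) => //.
  - move=> t; apply: cvgM.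
      by rewrite expr2; apply: cvgM; exact: y_cont.
    have : {within `[0, T], continuous E}; last exact.
    by apply: derivable_within_continuous => u _; case: (EE u).
  - move=> t /yE yt; have := is_deriveM (is_derive_sqr yt) (EE t).
    set d := (X in is_derive _ _ _ X) => h.
    suff -> : 2 * y t ^+ 2 * (c t - c s) * E t = d by exact: h.
    rewrite /d /k /GRing.scale/=; ring.
  - move=> t tT; have cst : 0 <= c t - c s.
      by rewrite subr_ge0; apply: cs; exact: subset_itv_oo_cc tT.
    by rewrite 2?mulr_ge0 ?expR_ge0// mulr_ge0 ?sqr_ge0.
apply: contraTneq => ->; rewrite expr0n mul0r -ltNge.
by rewrite mulr_gt0 ?expR_gt0// exprn_even_gt0.
Qed.

(** Once c has become positive, y^2 is nondecreasing, because its derivative is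
    2 c y^2; it then stays above one of its positive values. *)
Lemma linear_ode_not_cvg0 (R : realType) (y c : R -> R) (cstar : R) :
  (forall t : R, 0 < t -> is_derive t 1 y (y t * c t)) ->
  (forall t : R, 0 < t -> y t != 0) ->
  c t @[t --> +oo] --> cstar -> 0 < cstar -> ~ y t @[t --> +oo] --> 0.
Proof.
move=> yE y_neq0 ccstar cstar_gt0 y_cvg0.
have [A [_ cA]] := cvgr_gt _ ccstar _ cstar_gt0.
pose a := Num.max 0 A + 1.
have [a0 aA] : 0 < a /\ A < a.
  by rewrite /a; split; rewrite -[ltLHS]addr0 ler_ltD// !le_max lexx ?orbT.
have ya0 : 0 < y a ^+ 2 by rewrite exprn_even_gt0//= y_neq0.
have ysq_cvg0 : y t ^+ 2 @[t --> +oo] --> 0.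
  by rewrite -[X in _ --> X](mulr0 0); exact: cvgM.
have [B [_ yB]] := cvgr_lt _ ysq_cvg0 _ ya0.
pose b := Num.max a B + 1.
have [ab bB] : a < b /\ B < b.
  by rewrite /b; split; rewrite -[ltLHS]addr0 ler_ltD// !le_max lexx ?orbT.
have ysqE (t : R) : 0 < t ->
    is_derive t 1 (fun s => y s ^+ 2) (2 * y t * (y t * c t)).
  by move=> /yE/is_derive_sqr.
have /= := yB b bB; apply/negP; rewrite -leNgt.
apply: (@is_derive_ge0_le _ (fun t => y t ^+ 2)
  (fun t => 2 * y t * (y t * c t)) _ _ (ltW ab)).
- apply: derivable_within_continuous => t; rewrite in_itv/= => /andP[at_ _].
  by case: (ysqE t (lt_le_trans a0 at_)).
- by move=> t; rewrite in_itv/= => /andP[at_ _]; exact/ysqE/(lt_trans a0).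
- move=> t; rewrite in_itv/= => /andP[at_ _].
  rewrite -mulrA [y t * _]mulrA -expr2 mulr_ge0// mulr_ge0 ?sqr_ge0// ltW//.
  by apply: cA; exact: lt_trans at_.
Qed.

(** In evolutionary game theory this is the excess of the i-th payoff
    - grad_i Phi over the mean payoff of the population p. *)
Definition growth_rate (R : realType) (n : nat) (Phi : 'cV[R]_n -> R)
    (i : 'I_n) (p : 'cV[R]_n) : R :=
  dotv p (gradient Phi p) - gradient Phi p i 0.

Lemma dotvE (R : realType) (n : nat) (u v : 'cV[R]_n) :
  dotv u v = \sum_j u j 0 * v j 0.
Proof. by rewrite /dotv mxE; apply: eq_bigr => j _; rewrite mxE. Qed.

Lemma replicator_fieldE (R : realType) (n : nat) (Phi : 'cV[R]_n -> R)
    (p : 'cV[R]_n) (i : 'I_n) :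
  replicator_field Phi p i 0 = p i 0 * growth_rate Phi i p.
Proof.
rewrite /replicator_field /growth_rate mulmxBl -mulmxA !mxE.
rewrite (bigD1 i)//= big1 ?addr0; last first.
  by move=> j ji; rewrite !mxE eq_sym (negbTE ji) mulr0n mul0r.
rewrite big_ord1 !mxE eqxx mulr1n /dotv !mxE.
ring.
Qed.

Lemma growth_rate_continuous (R : realType) (n : nat) (Phi : 'cV[R]_n -> R)
    (p : 'cV[R]_n) (i : 'I_n) :
  {for p, continuous (gradient Phi)} -> {for p, continuous (growth_rate Phi i)}.
Proof.
move=> g_cont.
have gj j : {for p, continuous (fun q => gradient Phi q j 0)}.
  apply: (@continuous_comp _ _ _ (gradient Phi)
    (fun q : 'cV[R]_n => q j 0)) => //.
  exact: coord_continuous.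
have dot_cvg : dotv q (gradient Phi q) @[q --> p] --> dotv p (gradient Phi p).
  rewrite dotvE; under eq_fun do rewrite dotvE.
  apply: (cvg_big add_continuous (F := nbhs p)) => j _.
  by apply: cvgM; [exact: coord_continuous|exact: gj].
exact: cvgB dot_cvg (gj i).
Qed.

Lemma is_derive_coord (R : realType) (n : nat) (x : R -> 'cV[R]_n) (t : R)
    (d : 'cV[R]_n) (i : 'I_n) :
  is_derive t 1 x d -> is_derive t 1 (fun s => x s i 0) (d i 0).
Proof.
move=> [x_drv xE]; split; first by move/derivable_mxP: x_drv.
by rewrite -xE derive_mx// mxE.
Qed.

(** Differentiability gives continuity of the trajectory at positive times only;
    at the initial time it has to be read off the one-sided difference quotient
    by writing x h = x 0 + h (h^-1 (x h - x 0)). *)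
Lemma right_derivative_right_continuous (R : realType) (V : normedModType R)
    (x : R -> V) (d : V) :
  h^-1 *: (x h - x 0) @[h --> 0^'+] --> d -> x h @[h --> 0^'+] --> x 0.
Proof.
move=> xd.
have : x 0 + h *: (h^-1 *: (x h - x 0)) @[h --> 0^'+] --> x 0 + 0 *: d.
  apply: cvgD; first exact: cvg_cst.
  by apply: cvgZ => //; exact: (cvg_at_right_filter cvg_id).
rewrite scale0r addr0; apply: cvg_trans; apply: near_eq_cvg.
near=> h; rewrite scalerA divff ?scale1r 1?addrC ?subrK//.
Unshelve. all: by end_near. Qed.

Lemma within_continuous_half_line (R : realType) (f : R -> R) (T : R) :
  0 < T -> f t @[t --> 0^'+] --> f 0 ->
  (forall t : R, 0 < t -> {for t, continuous f}) ->
  {within `[0, T], continuous f}.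
Proof.
move=> T_gt0 f0 f_cont; apply/continuous_within_itvP => //; split => //.
  by move=> t; rewrite in_itv/= => /andP[/f_cont].
by apply: cvg_at_left_filter; exact: f_cont.
Qed.

Unset Implicit Arguments.
Set Strict Implicit.

Theorem proposition5p3 (R : realType) (n : nat) (U : set 'cV[R]_n)
    (Phi : 'cV[R]_n -> R) (x : R -> 'cV[R]_n) (xstar : 'cV[R]_n)
    (U_open : open U) (simplex_U : @simplex R n `<=` U)
    (Phi_C1 : continuously_differentiable_on U Phi)
    (grad_lip : locally_lipschitz_on U (gradient Phi))
    (x_sol : solves_ode U (replicator_field Phi) x)
    (x_init : ri_simplex (x 0))
    (xstar_simplex : simplex xstar)
    (x_cvg : x t @[t --> +oo] --> xstar) :
  let tau := dotv xstar (gradient Phi xstar) in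
  (forall i : 'I_n,
     (0 < xstar i 0 -> gradient Phi xstar i 0 = tau) /\
     (xstar i 0 = 0 -> gradient Phi xstar i 0 >= tau)) /\
  KKT_simplex Phi xstar.
Proof.
move=> tau.
have [xU x_right xE] := x_sol.
have rate_cont i p : U p -> {for p, continuous (growth_rate Phi i)}.
  by move=> /Phi_C1[_]; exact: growth_rate_continuous.
have x_coord (F : set_system R) (p : 'cV[R]_n) i : Filter F ->
    x t @[t --> F] --> p -> x t i 0 @[t --> F] --> p i 0.
  move=> FF xp.
  exact: (continuous_cvg FF (@coord_continuous R n 1 i 0 p) xp).
have rate_cvg i (F : set_system R) p : Filter F -> U p ->
    x t @[t --> F] --> p ->
    growth_rate Phi i (x t) @[t --> F] --> growth_rate Phi i p.
  by move=> FF Up; apply: continuous_cvg; exact: rate_cont.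
have xiE i (t : R) : 0 < t ->
    is_derive t 1 (fun s => x s i 0) (x t i 0 * growth_rate Phi i (x t)).
  by move=> /xE/(is_derive_coord i); rewrite replicator_fieldE.
have x_cvg0 : x t @[t --> 0^'+] --> x 0.
  exact: right_derivative_right_continuous x_right.
have x_cont (t : R) : 0 < t -> {for t, continuous x}.
  move=> /xE[x_drv _]; apply: differentiable_continuous.
  exact/derivable1_diffP.
have xi_neq0 i t : 0 < t -> x t i 0 != 0.
  move=> t_gt0.
  apply: (@linear_ode_neq0 _ (fun s => x s i 0)
    (fun s => growth_rate Phi i (x s)) t (ltW t_gt0)).
  - by apply: within_continuous_half_line => // [|s /x_cont]; exact: x_coord.
  - apply: within_continuous_half_line => // [|s s_gt0].
      by apply: rate_cvg => //; exact: xU.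
    by apply: rate_cvg; [exact/xU/ltW|exact: x_cont].
  - by move=> s; rewrite in_itv/= => /andP[+ _]; exact: xiE.
  - by rewrite gt_eqF//; case: x_init.
have xi_cvg i : x t i 0 @[t --> +oo] --> xstar i 0 by exact: x_coord.
have ratei_cvg i : growth_rate Phi i (x t) @[t --> +oo] -->
    growth_rate Phi i xstar by apply: rate_cvg => //; exact: simplex_U.
have interior i : 0 < xstar i 0 -> gradient Phi xstar i 0 = tau.
  move=> xi_gt0; apply/esym/eqP; rewrite -subr_eq0.
  (* This product is the limit of the derivative of the i-th coordinate. *)
  have : xstar i 0 * growth_rate Phi i xstar = 0.
    apply: (cvg_derive_lim0 (xiE i) (xi_cvg i)).
    by apply: cvgM; [exact: xi_cvg|exact: ratei_cvg].
  by move=> /eqP; rewrite mulf_eq0 gt_eqF.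
have boundary i : xstar i 0 = 0 -> tau <= gradient Phi xstar i 0.
  move=> xi0; rewrite leNgt -subr_gt0; apply/negP => rate_gt0.
  apply: (linear_ode_not_cvg0 (xiE i) (xi_neq0 i) (ratei_cvg i) rate_gt0).
  by rewrite -xi0.
split; first by move=> i; split; [exact: interior|exact: boundary].
have [xstar_ge0 _] := xstar_simplex.
have sign i : {xstar i 0 = 0} + {0 < xstar i 0}.
  have [|xi_neq] := eqVneq (xstar i 0) 0; first by left.
  by right; rewrite lt0r xi_neq/=.
pose lambda := gradient Phi xstar - tau *: const_mx 1.
have lambdaE i : lambda i 0 = gradient Phi xstar i 0 - tau.
  by rewrite /lambda [LHS]mxE; congr (_ + _); rewrite !mxE mulr1.
exists (- tau), lambda; split.
- by rewrite scaleNr subrr.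
- move=> i; rewrite lambdaE subr_ge0.
  by case: (sign i) => [/boundary|/interior ->].
- move=> i; rewrite lambdaE.
  by case: (sign i) => [->|/interior ->]; rewrite ?mulr0// subrr mul0r.
Qed.
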